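(* Let $m,n\ge 1$ and let $$K=\begin{bmatrix} A & B^T\\ B & -C\end{bmatrix}\in\mathbb{R}^{(m+n)\times(m+n)},$$ where $A\in\mathbb{R}^{m\times m}$ is symmetric positive definite, $B\in\mathbb{R}^{n\times m}$ has rank $n$, and $C\in\mathbb{R}^{n\times n}$ is symmetric positive semidefinite. Let $K=LJ_{m+n}L^T$ be a generalized Cholesky factorization of $K$. Let $\Delta K\in\mathbb{R}^{(m+n)\times(m+n)}$ be symmetric and suppose $$\|L^{-1}\|_2^2\,\|\Delta K\|_F<\tfrac12 .$$ Then $K+\Delta K$ has a generalized Cholesky factorization $$K+\Delta K=(L+\Delta L)J_{m+n}(L+\Delta L)^T,$$ where $L+\Delta L$ has the same block lower-triangular structure as $L$, and $$\|\Delta L\|_F\le \frac{\sqrt2\,\|L^{-1}\|_2\left[\inf_{D\in\mathbb{D}_{m+n}}\kappa_2(LD^{-1})\right]}{\sqrt2-1+\sqrt{1-2\|L^{-1}\|_2^2\|\Delta K\|_F}}\,\|\Delta K\|_F\le (2+\sqrt2)\,\|L^{-1}\|_2\left[\inf_{D\in\mathbb{D}_{m+n}}\kappa_2(LD^{-1})\right]\|\Delta K\|_F .$$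
   Context: $J_{m+n}=\begin{bmatrix} I_m&0\\0&-I_n\end{bmatrix}$. A generalized Cholesky factorization of a matrix $M\in\mathbb{R}^{(m+n)\times(m+n)}$ is a factorization $M=LJ_{m+n}L^T$ with $L=\begin{bmatrix}L_{11}&0\\L_{21}&L_{22}\end{bmatrix}$, where $L_{11}\in\mathbb{R}^{m\times m}$ and $L_{22}\in\mathbb{R}^{n\times n}$ are nonsingular lower triangular and $L_{21}\in\mathbb{R}^{n\times m}$ (so $L$ is nonsingular lower triangular); $L$ is called a generalized Cholesky factor. $\|\cdot\|_2$ is the spectral norm, $\|\cdot\|_F$ the Frobenius norm, $\kappa_2(X)=\|X\|_2\|X^{-1}\|_2$ for nonsingular $X$. $\mathbb{D}_{m+n}$ denotes the set of $(m+n)\times(m+n)$ diagonal matrices with positive diagonal entries. *)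

(* Defs.v *)
(* matrices over an arbitrary real closed field R
   (the real numbers being the intended instance). *)
From HB Require Import structures.
From mathcomp Require Import all_boot all_order all_algebra.
From Stdlib Require Import ClassicalEpsilon.
Set Implicit Arguments. Unset Strict Implicit. Unset Printing Implicit Defensive.
Import Order.TTheory GRing.Theory Num.Theory.
Local Open Scope ring_scope.

Section Defs.
Variable R : rcfType.

Definition is_lub (S : R -> Prop) (s : R) :=
  (forall x, S x -> x <= s) /\ (forall u, (forall x, S x -> x <= u) -> s <= u).
Definition is_glb (S : R -> Prop) (s : R) :=
  (forall x, S x -> s <= x) /\ (forall u, (forall x, S x -> u <= x) -> u <= s).

(* sup / inf: the lub / glb, chosen by classical choice (sets used below have one) *)
Definition sup (S : R -> Prop) : R := epsilon (inhabits 0) (is_lub S).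
Definition inf (S : R -> Prop) : R := epsilon (inhabits 0) (is_glb S).

Definition vnorm k (v : 'cV[R]_k) : R := Num.sqrt (\sum_i v i 0 ^+ 2).

Definition frob p q (A : 'M[R]_(p, q)) : R :=
  Num.sqrt (\sum_i \sum_j A i j ^+ 2).

Definition spec p q (A : 'M[R]_(p, q)) : R :=
  sup (fun r => exists x : 'cV[R]_q, x != 0 /\ r = vnorm (A *m x) / vnorm x).

Definition kappa2 p (X : 'M[R]_p) : R := spec X * spec (invmx X).

Definition Jmat m n : 'M[R]_(m + n) := block_mx 1%:M 0 0 (- 1%:M).

Definition gchol_factor m n (L : 'M[R]_(m + n)) : Prop :=
  exists (L11 : 'M[R]_m) (L21 : 'M[R]_(n, m)) (L22 : 'M[R]_n),
    L = block_mx L11 0 L21 L22 /\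
    is_trig_mx L11 /\ L11 \in unitmx /\ is_trig_mx L22 /\ L22 \in unitmx.

Definition gchol_factorization m n (M L : 'M[R]_(m + n)) : Prop :=
  gchol_factor L /\ M = L *m Jmat m n *m L^T.

Definition posdiag p (D : 'M[R]_p) : Prop :=
  is_diag_mx D /\ forall i, 0 < D i i.

Definition sym p (A : 'M[R]_p) : Prop := A^T = A.
Definition posdef p (A : 'M[R]_p) : Prop :=
  sym A /\ forall x : 'cV[R]_p, x != 0 -> 0 < (x^T *m A *m x) 0 0.
Definition possemidef p (A : 'M[R]_p) : Prop :=
  sym A /\ forall x : 'cV[R]_p, 0 <= (x^T *m A *m x) 0 0.

Definition kinf p (L : 'M[R]_p) : R :=
  inf (fun k => exists D : 'M[R]_p, posdiag D /\ k = kappa2 (L *m invmx D)).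

End Defs.

(* Main.v *)
(* Factor [L^-1 (K + dK) L^-T = J + E = (1 + X) J (1 + X)^T] with [X] lower triangular,
   and take [dL = L X].  The matrix [X J + J X^T = E - X J X^T] has [X J] as its lower
   triangular part up to a factor 2 on the diagonal, which gives both
   [sqrt 2 |X| <= |E| + |X|^2] and, row scaling by [D] being compatible with taking the
   lower triangle, [|D X| <= |D E| + |D X| |X|].  The first inequality confines [|X|] to
   one side of [sqrt (1/2)], and the side is settled by deforming one row at a time.

   Over an arbitrary real closed field neither compactness nor completeness is available;
   the existence of [spec] and [kinf] as least upper and greatest lower bounds comes from
   quantifier elimination, since a definable up-closed set has only finitely many
   possible cut points. *)
Require Import Defs.
From HB Require Import structures.
From mathcomp Require Import all_boot all_order all_algebra.
From mathcomp Require Import polyrcf ordered_qelim.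
From mathcomp Require qe_rcf.
From Stdlib Require Import Classical ClassicalEpsilon.
From mathcomp Require Import ring lra.
Set Implicit Arguments. Unset Strict Implicit. Unset Printing Implicit Defensive.
Import Order.TTheory GRing.Theory Num.Theory.
Local Open Scope ring_scope.

(** * Definable sets over a real closed field *)

Section Definability.
Variable R : rcfType.

(** Truth is tested only in environments of length [n], so variable [n] is fresh, and a quantifier
    over it appends one entry to the environment. *)
Definition definable n (P : seq R -> Prop) :=
  exists f : ord.formula R, forall e, size e = n -> ord.holds e f <-> P e.

Definition polyfun n (g : seq R -> R) :=
  exists t : GRing.term R, forall e, size e = n -> GRing.eval e t = g e.

Lemma polyfun_const n c : polyfun n (fun=> c).
Proof. by exists (GRing.Const c). Qed.

Lemma polyfun_nth n i : polyfun n (fun e => e`_i).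
Proof. by exists (GRing.Var R i). Qed.

Lemma polyfunD n g h : polyfun n g -> polyfun n h -> polyfun n (fun e => g e + h e).
Proof.
by move=> [t tP] [u uP]; exists (GRing.Add t u) => e se /=; rewrite tP ?uP.
Qed.

Lemma polyfunM n g h : polyfun n g -> polyfun n h -> polyfun n (fun e => g e * h e).
Proof.
by move=> [t tP] [u uP]; exists (GRing.Mul t u) => e se /=; rewrite tP ?uP.
Qed.

Lemma polyfun_sqr n g : polyfun n g -> polyfun n (fun e => g e ^+ 2).
Proof. exact: (fun gP => polyfunM gP gP). Qed.

Lemma polyfun_sum n k (g : 'I_k -> seq R -> R) :
  (forall i, polyfun n (g i)) -> polyfun n (fun e => \sum_i g i e).
Proof.
elim: k g => [|k IH] g gP.
  by exists (GRing.Const 0) => e _; rewrite big_ord0.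
have [t tP] := polyfunD (IH _ (fun i => gP (widen_ord (leqnSn k) i))) (gP ord_max).
by exists t => e se; rewrite tP // big_ord_recr.
Qed.

Lemma definable_le n g h :
  polyfun n g -> polyfun n h -> definable n (fun e => g e <= h e).
Proof.
by move=> [t tP] [u uP]; exists (ord.Le t u) => e se /=; rewrite tP ?uP.
Qed.

Lemma definable_lt n g h :
  polyfun n g -> polyfun n h -> definable n (fun e => g e < h e).
Proof.
by move=> [t tP] [u uP]; exists (ord.Lt t u) => e se /=; rewrite tP ?uP.
Qed.

Lemma definable_and n P Q :
  definable n P -> definable n Q -> definable n (fun e => P e /\ Q e).
Proof.
move=> [f fP] [g gP]; exists (ord.And f g) => e se /=.
by rewrite fP ?gP.
Qed.

Lemma definable_all_ord n k (P : 'I_k -> seq R -> Prop) :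
  (forall i, definable n (P i)) -> definable n (fun e => forall i, P i e).
Proof.
elim: k P => [|k IH] P dP.
  by exists (ord.Bool true) => e _; split => // _ [].
have [f fP] := definable_and (IH _ (fun i => dP (lift ord0 i))) (dP ord0).
exists f => e se; rewrite fP //; split=> [[PS P0] i|Pe]; last by split.
by case: (unliftP ord0 i) => [j|] ->.
Qed.

(** * Quantification over blocks of variables *)

Lemma set_nth_rcons (e : seq R) x : set_nth 0 e (size e) x = rcons e x.
Proof. by elim: e => //= y e ->. Qed.

(** Reading [n + k.+1] as [n.+1 + k], the induction hypothesis binds the last [k] variables, and one
    more quantifier binds the entry at position [n]. *)
Lemma definable_ex n k P : definable (n + k) P ->
  definable n (fun e => exists2 z, size z = k & P (e ++ z)).
Proof.
elim: k n => [|k IH] n.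
  rewrite addn0 => -[f fP]; exists f => e se; rewrite fP //; split=> [Pe|].
    by exists [::]; rewrite ?cats0.
  by move=> [z /size0nil ->]; rewrite cats0.
rewrite -addSnnS => /IH[f fP]; exists (ord.Exists n f) => e se /=; split.
  move=> [x]; rewrite -{1}se set_nth_rcons fP ?size_rcons ?se // => -[z sz].
  by rewrite cat_rcons => Pz; exists (x :: z); rewrite //= sz.
move=> [[//|x z] [sz] Pz]; exists x.
rewrite -{1}se set_nth_rcons fP ?size_rcons ?se //; exists z => //.
by rewrite cat_rcons.
Qed.

Lemma definable_all n k P : definable (n + k) P ->
  definable n (fun e => forall z, size z = k -> P (e ++ z)).
Proof.
elim: k n => [|k IH] n.
  rewrite addn0 => -[f fP]; exists f => e se; rewrite fP //; split=> [Pe|Pe].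
    by move=> z /size0nil ->; rewrite cats0.
  by rewrite -[e]cats0; apply: Pe.
rewrite -addSnnS => /IH[f fP]; exists (ord.Forall n f) => e se /=; split.
  move=> h [//|x z] [sz]; rewrite -cat_rcons.
  by move: (h x); rewrite -{1}se set_nth_rcons fP ?size_rcons ?se //; apply.
move=> h x; rewrite -{1}se set_nth_rcons fP ?size_rcons ?se // => z sz.
by rewrite cat_rcons; apply: h; rewrite /= sz.
Qed.

(** * Cut points of definable sets in one variable *)

(** [rterm] rules out inverses, which leaves only polynomial operations on the one variable. *)
Lemma rterm_poly (t : GRing.term R) : GRing.rterm t ->
  exists p : {poly R}, forall x, GRing.eval [:: x] t = p.[x].
Proof.
elim: t => //=.
- move=> [|i] _; first by exists 'X => x; rewrite hornerX.
  (* Variables beyond the single entry of the environment read the default 0. *)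
  by exists 0 => x; rewrite horner0 nth_default.
- by move=> c _; exists c%:P => x; rewrite hornerC.
- by move=> k _; exists (k%:R)%:P => x; rewrite hornerC.
- move=> t IHt u IHu /andP[/IHt[p pP] /IHu[q qP]].
  by exists (p + q) => x; rewrite hornerD pP qP.
- by move=> t IHt /IHt[p pP]; exists (- p) => x; rewrite hornerN pP.
- by move=> t IHt k /IHt[p pP]; exists (p *+ k) => x; rewrite hornerMn pP.
- move=> t IHt u IHu /andP[/IHt[p pP] /IHu[q qP]].
  by exists (p * q) => x; rewrite hornerM pP qP.
- by move=> t IHt k /IHt[p pP]; exists (p ^+ k) => x; rewrite horner_exp pP.
Qed.

Definition avoids (s : seq R) x y := all (fun z => ~~ (x <= z <= y)) s.

Lemma avoids_cat s1 s2 x y :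
  avoids (s1 ++ s2) x y = avoids s1 x y && avoids s2 x y.
Proof. exact: all_cat. Qed.

(** The cut points are the roots: by the intermediate value property the sign cannot change on a
    closed interval without roots. The zero polynomial gets the empty list. *)
Lemma poly_sign_avoids (p : {poly R}) :
  exists s : seq R, forall x y, x <= y -> avoids s x y -> Num.sg p.[x] = Num.sg p.[y].
Proof.
have [->|p0] := eqVneq p 0; first by exists [::] => x y; rewrite !horner0.
exists (rootsR p) => x y xy /allP sxy.
apply: (@polyrN0_itv _ `[x, y]); rewrite ?in_itv /= ?lexx ?xy //.
move=> z zxy; apply/negP => rz; have /sxy/negP[] : z \in rootsR p.
  by rewrite -(roots_on_rootsR p0) rz in_itv.
by move: zxy; rewrite in_itv.
Qed.

(** Each atom depends on the sign of a difference of two polynomials, and a Boolean combination can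
    only change where one of its parts does, so the lists of cut points are concatenated. *)
Lemma qf_eval_avoids (f : ord.formula R) : ord.qf_form f -> ord.rformula f ->
  exists s : seq R, forall x y, x <= y -> avoids s x y ->
    ord.qf_eval [:: x] f = ord.qf_eval [:: y] f.
Proof.
have atom (t u : GRing.term R) : GRing.rterm t && GRing.rterm u ->
    exists s : seq R, forall x y, x <= y -> avoids s x y ->
    Num.sg (GRing.eval [:: x] t - GRing.eval [:: x] u) =
    Num.sg (GRing.eval [:: y] t - GRing.eval [:: y] u).
  move=> /andP[/rterm_poly[p pP] /rterm_poly[q qP]].
  have [s sP] := poly_sign_avoids (p - q); exists s => x y xy /(sP _ _ xy).
  by rewrite !hornerE !pP !qP.
have bin (op : bool -> bool -> bool) (g h : R -> bool) :
    (exists s : seq R, forall x y, x <= y -> avoids s x y -> g x = g y) ->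
    (exists s : seq R, forall x y, x <= y -> avoids s x y -> h x = h y) ->
    exists s : seq R, forall x y, x <= y -> avoids s x y -> op (g x) (h x) = op (g y) (h y).
  move=> [s1 h1] [s2 h2]; exists (s1 ++ s2) => x y xy.
  by rewrite avoids_cat => /andP[/(h1 _ _ xy)-> /(h2 _ _ xy)->].
elim: f => //=.
- by move=> b _ _; exists [::].
- move=> t u _ /atom[s sP]; exists s => x y xy /(sP _ _ xy) E.
  by rewrite -subr_eq0 -sgr_eq0 E sgr_eq0 subr_eq0.
- move=> t u _ /atom[s sP]; exists s => x y xy /(sP _ _ xy) E.
  by rewrite -subr_lt0 -sgr_lt0 E sgr_lt0 subr_lt0.
- move=> t u _ /atom[s sP]; exists s => x y xy /(sP _ _ xy) E.
  by rewrite -subr_le0 -sgr_le0 E sgr_le0 subr_le0.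
- by move=> f If g Ig /andP[/If{}If /Ig{}Ig] /andP[/If{}If /Ig{}Ig]; apply: (bin andb).
- by move=> f If g Ig /andP[/If{}If /Ig{}Ig] /andP[/If{}If /Ig{}Ig]; apply: (bin orb).
- by move=> f If g Ig /andP[/If{}If /Ig{}Ig] /andP[/If{}If /Ig{}Ig]; apply: (bin implb).
- by move=> f If /If{}If /If[s sP]; exists s => x y xy /(sP _ _ xy) ->.
Qed.

(** Removing inverses and then eliminating quantifiers gives an equivalent quantifier-free formula,
    to which the finite list of cut points applies. *)
Lemma definable_avoids P : definable 1 P ->
  exists s : seq R, forall x y, x <= y -> avoids s x y -> P [:: x] <-> P [:: y].
Proof.
move=> [f fP].
pose wproj i bc := qe_rcf.qfr_to_formula (@qe_rcf.wproj R i bc).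
set g := ord.quantifier_elim wproj (ord.to_rform f).
have /andP[qg rg] : ord.qf_form g && ord.rformula g.
  exact: ord.quantifier_elim_wf (@qe_rcf.wf_QE_wproj R) _ (ord.to_rform_rformula f).
have [s sP] := qf_eval_avoids qg rg; exists s => x y xy /(sP _ _ xy) E.
have gP e : reflect (ord.holds e f) (ord.qf_eval e g) := qe_rcf.rcf_satP e f.
rewrite -(fP [:: x] erefl) -(fP [:: y] erefl).
by split=> /gP h; apply/gP; rewrite ?E // -E.
Qed.

(** This replaces completeness. Induction on the cut points: one inside []a, b[] becomes the new [a]
    or the new [b] according to whether it lies in [Q], and any other is dropped. Once none is left,
    [Q] is constant on []a, b[], and the midpoint tells whether the bound is [a] or [b]. *)
Lemma upset_glb (Q : R -> Prop) (s : seq R) (a b : R) :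
  (forall u v, Q u -> u <= v -> Q v) -> ~ Q a -> Q b ->
  (forall x y, a < x -> x <= y -> y < b -> avoids s x y -> Q x <-> Q y) ->
  exists g, is_glb Q g.
Proof.
move=> up; elim: s a b => [|c s IH] a b nQa Qb H.
  have lb x y : ~ Q x -> Q y -> x < y.
    by move=> nQx Qy; rewrite ltNge; apply/negP => /(up _ _ Qy).
  have ab := lb _ _ nQa Qb; have [am mb] := midf_lt ab.
  case: (classic (Q ((a + b) / 2))) => [Qm|nQm].
    exists a; split=> [x Qx|u ub]; first exact: ltW (lb _ _ nQa Qx).
    rewrite leNgt; apply/negP => au.
    have [x /andP[ax]] : exists x, a < x < Num.min u ((a + b) / 2).
      by exists ((a + Num.min u ((a + b) / 2)) / 2); rewrite !midf_lt // lt_min au.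
    rewrite lt_min => /andP[xu xm].
    have Qx : Q x by apply: (iffRL (H x _ ax (ltW xm) mb isT)).
    by have := ub _ Qx; rewrite leNgt xu.
  exists b; split=> [x Qx|u]; last exact.
  rewrite leNgt; apply/negP => xb; have mx := lb _ _ nQm Qx.
  by apply: nQm; apply/(H _ x am (ltW mx) xb isT).
case: (boolP (a < c < b)) => [/andP[ac cb]|cab]; last first.
  apply: (IH a b nQa Qb) => x y ax xy yb sxy; apply: H => //=; rewrite sxy andbT.
  apply: contra cab => /andP[xc cy].
  by rewrite (lt_le_trans ax xc) (le_lt_trans cy yb).
case: (classic (Q c)) => [Qc|nQc].
  apply: (IH a c nQa Qc) => x y ax xy yc sxy.
  by apply: H => //=; rewrite ?(lt_trans yc) // sxy andbT negb_and -!ltNge yc orbT.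
apply: (IH c b nQc Qb) => x y cx xy yb sxy.
by apply: H => //=; rewrite ?(lt_trans ac) // sxy andbT negb_and -!ltNge cx.
Qed.

Lemma definable_upset_glb (P : seq R -> Prop) (a b : R) :
  definable 1 P -> (forall u v, P [:: u] -> u <= v -> P [:: v]) ->
  ~ P [:: a] -> P [:: b] -> exists g, is_glb (fun u => P [:: u]) g.
Proof.
move=> /definable_avoids[s sP] up nPa Pb.
by apply: (upset_glb up nPa Pb) => x y _ xy _; apply: sP.
Qed.

End Definability.

(** * Frobenius and spectral norms *)

Section Frobenius.
Variable R : rcfType.

(** The square of [frob] is polynomial in the entries, so it can occur in a formula. *)
Definition fsq p q (A : 'M[R]_(p, q)) : R := \sum_i \sum_j A i j ^+ 2.

Lemma fsq_ge0 p q (A : 'M[R]_(p, q)) : 0 <= fsq A.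
Proof. by do 2!apply: sumr_ge0 => ? _; apply: sqr_ge0. Qed.

Lemma frob_ge0 p q (A : 'M[R]_(p, q)) : 0 <= frob A.
Proof. exact: sqrtr_ge0. Qed.

Lemma frob_sqr p q (A : 'M[R]_(p, q)) : frob A ^+ 2 = fsq A.
Proof. by rewrite sqr_sqrtr ?fsq_ge0. Qed.

Lemma ler_frob p q (A : 'M[R]_(p, q)) x : 0 <= x -> fsq A <= x ^+ 2 -> frob A <= x.
Proof. by move=> x0; rewrite -frob_sqr ler_sqr // nnegrE frob_ge0. Qed.

Lemma frob_le p q r s (A : 'M[R]_(p, q)) (B : 'M[R]_(r, s)) :
  fsq A <= fsq B -> frob A <= frob B.
Proof. by move=> AB; apply: ler_wsqrtr. Qed.

Lemma vnormE p (v : 'cV[R]_p) : vnorm v = frob v.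
Proof. by congr Num.sqrt; apply: eq_bigr => i _; rewrite big_ord1. Qed.

Lemma fsq_eq0 p q (A : 'M[R]_(p, q)) : (fsq A == 0) = (A == 0).
Proof.
rewrite /fsq psumr_eq0; last by move=> i _; apply: sumr_ge0 => j _; apply: sqr_ge0.
apply/allP/eqP => [h|-> i _]; last first.
  by rewrite big1 ?eqxx // => j _; rewrite mxE expr0n.
apply/matrixP => i j; have := h i (mem_index_enum i).
rewrite /= psumr_eq0 => [/allP/(_ j (mem_index_enum j))|k _]; last exact: sqr_ge0.
by rewrite /= sqrf_eq0 mxE => /eqP.
Qed.

Lemma frob_gt0 p q (A : 'M[R]_(p, q)) : (0 < frob A) = (A != 0).
Proof. by rewrite sqrtr_gt0 lt0r fsq_ge0 andbT fsq_eq0. Qed.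

Lemma frob_eq0 p q (A : 'M[R]_(p, q)) : (frob A == 0) = (A == 0).
Proof. by rewrite eq_le frob_ge0 andbT leNgt frob_gt0 negbK. Qed.

Lemma fsq0 p q : fsq (0 : 'M[R]_(p, q)) = 0.
Proof. by apply/eqP; rewrite fsq_eq0. Qed.

Lemma frob0 p q : frob (0 : 'M[R]_(p, q)) = 0.
Proof. by apply/eqP; rewrite frob_eq0. Qed.

Lemma fsq_tr p q (A : 'M[R]_(p, q)) : fsq A^T = fsq A.
Proof.
by rewrite /fsq exchange_big; do 2!apply: eq_bigr => ? _; rewrite mxE.
Qed.

Lemma frob_tr p q (A : 'M[R]_(p, q)) : frob A^T = frob A.
Proof. by congr Num.sqrt; apply: fsq_tr. Qed.

Lemma fsqZ p q a (A : 'M[R]_(p, q)) : fsq (a *: A) = a ^+ 2 * fsq A.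
Proof.
rewrite /fsq mulr_sumr; apply: eq_bigr => i _; rewrite mulr_sumr.
by apply: eq_bigr => j _; rewrite mxE exprMn.
Qed.

Lemma fsqN p q (A : 'M[R]_(p, q)) : fsq (- A) = fsq A.
Proof. by rewrite -scaleN1r fsqZ sqrrN expr1n mul1r. Qed.

Lemma frobN p q (A : 'M[R]_(p, q)) : frob (- A) = frob A.
Proof. by congr Num.sqrt; apply: fsqN. Qed.

Lemma fsq_block m1 m2 n1 n2 (A : 'M[R]_(m1, n1)) (B : 'M_(m1, n2))
    (C : 'M_(m2, n1)) (D : 'M_(m2, n2)) :
  fsq (block_mx A B C D) = fsq A + fsq B + fsq C + fsq D.
Proof.
rewrite /fsq big_split_ord -addrA -!big_split /=; congr (_ + _).
  apply: eq_bigr => i _; rewrite big_split_ord /=.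
  by congr (_ + _); apply: eq_bigr => j _; rewrite ?block_mxEul ?block_mxEur.
apply: eq_bigr => i _; rewrite big_split_ord /=.
by congr (_ + _); apply: eq_bigr => j _; rewrite ?block_mxEdl ?block_mxEdr.
Qed.

(** Lagrange's identity: twice the difference of the two sides is $\sum_{i,j}(a_ib_j-a_jb_i)^2$. *)
Lemma cauchy_schwarz (I : finType) (a b : I -> R) :
  (\sum_i a i * b i) ^+ 2 <= (\sum_i a i ^+ 2) * (\sum_i b i ^+ 2).
Proof.
rewrite -subr_ge0 -(pmulrn_lge0 _ (ltn0Sn 1)).
suff -> : ((\sum_i a i ^+ 2) * (\sum_i b i ^+ 2) - (\sum_i a i * b i) ^+ 2) *+ 2 =
    \sum_i \sum_j (a i * b j - a j * b i) ^+ 2.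
  by do 2!apply: sumr_ge0 => ? _; apply: sqr_ge0.
have E (f g : I -> R) : (\sum_i f i) * (\sum_i g i) = \sum_i \sum_j f i * g j.
  by rewrite mulr_suml; apply: eq_bigr => i _; rewrite mulr_sumr.
rewrite mulr2n {1}[in X in X - _]mulrC expr2 !E.
rewrite addrACA -opprD -!big_split -sumrB /=; apply: eq_bigr => i _.
rewrite -!big_split -sumrB /=; apply: eq_bigr => j _; ring.
Qed.

Lemma frobD p q (A B : 'M[R]_(p, q)) : frob (A + B) <= frob A + frob B.
Proof.
apply: ler_frob; first by rewrite addr_ge0 ?frob_ge0.
have fsqP (C : 'M[R]_(p, q)) : fsq C = \sum_k C k.1 k.2 ^+ 2.
  by rewrite /fsq pair_bigA.
have CS : \sum_k A k.1 k.2 * B k.1 k.2 <= frob A * frob B.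
  apply: (le_trans (ler_norm _)).
  rewrite -ler_sqr ?nnegrE ?mulr_ge0 ?frob_ge0 // exprMn !frob_sqr !fsqP.
  by rewrite real_normK ?num_real //; apply: cauchy_schwarz.
have -> : fsq (A + B) = fsq A + fsq B + (\sum_k A k.1 k.2 * B k.1 k.2) *+ 2.
  rewrite !fsqP -sumrMnl -!big_split; apply: eq_bigr => k _ /=; rewrite mxE; ring.
by rewrite sqrrD !frob_sqr [leRHS]addrAC lerD2l ler_pMn2r.
Qed.

Lemma frobM p q r (A : 'M[R]_(p, q)) (B : 'M[R]_(q, r)) :
  frob (A *m B) <= frob A * frob B.
Proof.
apply: ler_frob; first by rewrite mulr_ge0 ?frob_ge0.
rewrite exprMn !frob_sqr -[fsq B]fsq_tr /fsq mulr_suml; apply: ler_sum => i _.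
rewrite mulr_sumr; apply: ler_sum => j _; rewrite mxE.
apply: le_trans (cauchy_schwarz _ _) _.
by under [X in _ <= _ * X]eq_bigr do rewrite mxE.
Qed.

Lemma fsq_col p q (A : 'M[R]_(p, q)) : fsq A = \sum_j fsq (col j A).
Proof.
rewrite /fsq exchange_big; apply: eq_bigr => j _; apply: eq_bigr => i _.
by rewrite big_ord1 mxE.
Qed.

(** * First-order bounds on matrix-vector products and the spectral norm *)

(** Vectors enter formulas as runs of [q] consecutive environment entries; [k] is the offset of the
    run. *)
Definition subcol q k (e : seq R) : 'cV[R]_q := \col_j e`_(k + j).

Lemma polyfun_fsq n p q k (M : 'M[R]_(p, q)) :
  polyfun n (fun e => fsq (M *m subcol q k e)).
Proof.
have [t tP] : polyfun n (fun e => \sum_i (\sum_j M i j * e`_(k + j)) ^+ 2).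
  apply: polyfun_sum => i; apply: polyfun_sqr; apply: polyfun_sum => j.
  exact (polyfunM (polyfun_const n (M i j)) (polyfun_nth R n (k + j))).
exists t => e /tP ->; apply: eq_bigr => i _; rewrite big_ord1 mxE.
by congr (_ ^+ 2); apply: eq_bigr => j _; rewrite mxE.
Qed.

Lemma subcol_cat q (e z : seq R) : subcol q (size e) (e ++ z) = subcol q 0 z.
Proof. by apply/colP => j; rewrite !mxE nth_cat ltnNge leq_addr /= addKn. Qed.

Lemma subcol_mkseq q (x : 'cV[R]_q) : subcol q 0 [seq x i 0 | i <- enum 'I_q] = x.
Proof.
by apply/colP => j; rewrite mxE (nth_map j) ?size_enum_ord ?ltn_ord // nth_ord_enum.
Qed.

Lemma all_subcol q (P : 'cV[R]_q -> Prop) :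
  (forall z : seq R, size z = q -> P (subcol q 0 z)) <-> (forall x, P x).
Proof.
split=> h z => [|_]; last exact: h.
by rewrite -[z]subcol_mkseq; apply: h; rewrite size_map size_enum_ord.
Qed.

Lemma ex_subcol q (P : 'cV[R]_q -> Prop) :
  (exists2 z : seq R, size z = q & P (subcol q 0 z)) <-> (exists x, P x).
Proof.
split=> [[z _]|[x]]; first by exists (subcol q 0 z).
by rewrite -{1}[x]subcol_mkseq; eexists; last eassumption; rewrite size_map size_enum_ord.
Qed.

Lemma definable_iff n (P Q : seq R -> Prop) : definable n P ->
  (forall e, size e = n -> P e <-> Q e) -> definable n Q.
Proof. by move=> [f fP] PQ; exists f => e se; rewrite fP ?PQ. Qed.

(** The upper bounds of the quotients that define [spec], cleared of division; the sign condition
    makes squaring both sides an equivalence. *)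
Definition spec_bound p q (M : 'M[R]_(p, q)) u :=
  0 <= u /\ forall x : 'cV[R]_q, frob (M *m x) <= u * frob x.

Lemma frob_le_mul p q r s (A : 'M[R]_(p, q)) (B : 'M[R]_(r, s)) u : 0 <= u ->
  (frob A <= u * frob B) = (fsq A <= u ^+ 2 * fsq B).
Proof.
by move=> u0; rewrite -!frob_sqr -exprMn ler_sqr ?nnegrE ?mulr_ge0 ?frob_ge0.
Qed.

Lemma spec_bound_definable p q (M : 'M[R]_(p, q)) :
  definable 1 (fun e => spec_bound M e`_0).
Proof.
have dP : definable 1 (fun e => 0 <= e`_0 /\ forall z, size z = q ->
    (* The factor [1%:M] brings the norm of the vector itself into the form treated by
       [polyfun_fsq]. *)
    fsq (M *m subcol q 1 (e ++ z)) <= (e ++ z)`_0 ^+ 2 * fsq (1%:M *m subcol q 1 (e ++ z))).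
  apply: definable_and; first exact (definable_le (polyfun_const 1 0) (polyfun_nth R 1 0)).
  pose P e := fsq (M *m subcol q 1 e) <= e`_0 ^+ 2 * fsq (1%:M *m subcol q 1 e).
  apply: (@definable_all _ _ q P); apply: definable_le; first exact: polyfun_fsq.
  exact (polyfunM (polyfun_sqr (polyfun_nth R _ 0)) (polyfun_fsq _ 1 1%:M)).
apply: (definable_iff dP) => -[//|u [|//]] _; rewrite /spec_bound /=.
have E z : subcol q 1 (u :: z) = subcol q 0 z by exact: (subcol_cat q [:: u]).
rewrite -(all_subcol (fun x => frob (M *m x) <= u * frob x)).
by split=> -[u0 h]; split=> // z /h; rewrite !E mul1mx frob_le_mul.
Qed.

Lemma spec_bound_frob p q (M : 'M[R]_(p, q)) : spec_bound M (frob M).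
Proof. by split=> [|x]; [apply: frob_ge0|apply: frobM]. Qed.

(** The least upper bound is obtained as the greatest lower bound of the definable up-closed set of
    upper bounds, which contains [frob M] and not -1. *)
Lemma spec_is_lub p q (M : 'M[R]_(p, q)) : (0 < q)%N ->
  is_lub (fun r => exists x : 'cV[R]_q, x != 0 /\ r = vnorm (M *m x) / vnorm x) (spec M).
Proof.
case: q M => // q M _; apply: epsilon_spec.
have [|||g [lb gt]] := @definable_upset_glb R _ (- 1) (frob M) (spec_bound_definable M).
- move=> u v /= [u0 uP] uv; split=> [|x]; first exact: le_trans uv.
  by apply: (le_trans (uP x)); rewrite ler_wpM2r ?frob_ge0.
- by case=> /=; rewrite oppr_ge0 ler10.
- exact: spec_bound_frob.
exists g; split=> [r [x [x0 ->]]|u ub].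
  rewrite !vnormE; apply: gt => u [u0 uP].
  by rewrite ler_pdivrMr ?frob_gt0.
apply: lb; split=> /= [|x].
  (* In positive dimension a nonzero vector exists, and its quotient forces every upper bound to be
     nonnegative. *)
  have c0 : const_mx 1 != 0 :> 'cV[R]_q.+1.
    by apply/eqP => /matrixP/(_ 0 0)/eqP; rewrite !mxE oner_eq0.
  apply: (le_trans _ (ub _ (ex_intro _ (const_mx 1) (conj c0 erefl)))).
  by rewrite !vnormE divr_ge0 ?frob_ge0.
have [->|x0] := eqVneq x 0.
  by rewrite mulmx0 !frob0 mulr0.
by have := ub _ (ex_intro _ x (conj x0 erefl)); rewrite !vnormE ler_pdivrMr ?frob_gt0.
Qed.

Section Spec.
Variables (p q : nat) (M : 'M[R]_(p, q)).
Hypothesis q0 : (0 < q)%N.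

Lemma spec_boundP : spec_bound M (spec M).
Proof.
have [ub _] := spec_is_lub M q0; split.
  case: q M q0 ub => // q' M' _ ub.
  have c0 : const_mx 1 != 0 :> 'cV[R]_q'.+1.
    by apply/eqP => /matrixP/(_ 0 0)/eqP; rewrite !mxE oner_eq0.
  apply: (le_trans _ (ub _ (ex_intro _ (const_mx 1) (conj c0 erefl)))).
  by rewrite !vnormE divr_ge0 ?frob_ge0.
move=> x; have [->|x0] := eqVneq x 0.
  by rewrite mulmx0 !frob0 mulr0.
by have := ub _ (ex_intro _ x (conj x0 erefl)); rewrite !vnormE ler_pdivrMr ?frob_gt0.
Qed.

Lemma spec_ge0 : 0 <= spec M. Proof. by case: spec_boundP. Qed.

Lemma spec_le u : spec_bound M u -> spec M <= u.
Proof.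
move=> [u0 uP]; have [_] := spec_is_lub M q0; apply => r [x [x0 ->]].
by rewrite !vnormE ler_pdivrMr ?frob_gt0.
Qed.

(** Squared Frobenius norms add up over columns, so the vector bound is applied to each column of
    [N]. *)
Lemma frob_spec_mul r (N : 'M[R]_(q, r)) : frob (M *m N) <= spec M * frob N.
Proof.
rewrite frob_le_mul ?spec_ge0 // !fsq_col mulr_sumr; apply: ler_sum => j _.
by rewrite colE -mulmxA -colE -frob_le_mul ?spec_ge0 //; case: spec_boundP.
Qed.

Lemma spec_gt0 : M != 0 -> 0 < spec M.
Proof.
move=> M0; rewrite lt0r spec_ge0 andbT; apply: contra M0 => /eqP s0.
have := frob_spec_mul 1%:M; rewrite s0 mulmx1 mul0r => h.
by rewrite -frob_eq0 eq_le h frob_ge0.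
Qed.

End Spec.
End Frobenius.

(** * The optimal diagonal scaling *)

Section Kinf.
Variable R : rcfType.

Definition diagc p (d : 'cV[R]_p) : 'M[R]_p := diag_mx d^T.

(** For invertible [L], substituting [z = L^-1 y] in the first inequality and [z = D^-1 y] in the
    second shows that they bound [spec (D L^-1)] by 1 and [spec (L D^-1)] by [u], without mentioning
    any inverse. *)
Definition kappa_bound p (L : 'M[R]_p) u := 0 <= u /\
  exists d : 'cV[R]_p, (forall i, 0 < d i 0) /\ forall z : 'cV[R]_p,
    frob (diagc d *m z) <= frob (L *m z) /\ frob (L *m z) <= u * frob (diagc d *m z).

Lemma polyfun_fsq_diag n p k l :
  polyfun n (fun e => fsq (diagc (subcol p k e) *m subcol p l e)).
Proof.
have [t tP] : polyfun n (fun e : seq R => \sum_(i < p) (e`_(k + i) * e`_(l + i)) ^+ 2).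
  apply: polyfun_sum => i.
  exact (polyfun_sqr (polyfunM (polyfun_nth R n (k + i)) (polyfun_nth R n (l + i)))).
exists t => e /tP ->; apply: eq_bigr => i _.
by rewrite big_ord1 mul_diag_mx !mxE.
Qed.

Lemma kappa_bound_definable p (L : 'M[R]_p) :
  definable 1 (fun e => kappa_bound L e`_0).
Proof.
(* Layout of the environment: [u] at position 0, the diagonal [d] from position 1, the test vector
   [z] from position [1 + p]. *)
pose Q e := fsq (diagc (subcol p 1 e) *m subcol p (1 + p) e) <= fsq (L *m subcol p (1 + p) e)
  /\ fsq (L *m subcol p (1 + p) e) <=
     e`_0 ^+ 2 * fsq (diagc (subcol p 1 e) *m subcol p (1 + p) e).
have dQ : definable (1 + p + p) Q.
  apply: definable_and; first
    exact (definable_le (polyfun_fsq_diag _ p 1 (1 + p)) (polyfun_fsq _ (1 + p) L)).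
  apply: definable_le; first exact: polyfun_fsq.
  exact (polyfunM (polyfun_sqr (polyfun_nth R _ 0)) (polyfun_fsq_diag _ p 1 (1 + p))).
pose P (e : seq R) := (forall i : 'I_p, 0 < e`_(1 + i)) /\
  forall z, size z = p -> Q (e ++ z).
have dP : definable (1 + p) P.
  apply: definable_and; last exact: definable_all.
  apply: definable_all_ord => i.
  exact (definable_lt (polyfun_const _ 0) (polyfun_nth R _ (1 + i))).
have dE := definable_and (definable_le (polyfun_const 1 0) (polyfun_nth R 1 0))
  (definable_ex dP).
apply: (definable_iff dE) => -[//|u [|//]] _; rewrite /kappa_bound /=.
have E1 (d : seq R) : subcol p 1 (u :: d) = subcol p 0 d by exact: (subcol_cat p [:: u]).
have E2 (d z : seq R) : size d = p -> subcol p 1 (u :: d ++ z) = subcol p 0 d.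
  move=> sd; apply/colP => i.
  by rewrite !mxE /= nth_cat sd ltn_ord.
have E3 (d z : seq R) : size d = p -> subcol p (1 + p) (u :: d ++ z) = subcol p 0 z.
  by move=> sd; rewrite -(subcol_cat p (u :: d)) /= sd.
rewrite -ex_subcol.
have PE (d : seq R) : 0 <= u -> size d = p -> P (u :: d) <->
   (forall i, 0 < subcol p 0 d i 0) /\ forall z : 'cV[R]_p,
   frob (diagc (subcol p 0 d) *m z) <= frob (L *m z) /\
   frob (L *m z) <= u * frob (diagc (subcol p 0 d) *m z).
  move=> u0 sd; have fE (z : 'cV[R]_p) :
      (frob (diagc (subcol p 0 d) *m z) <= frob (L *m z)) =
      (fsq (diagc (subcol p 0 d) *m z) <= fsq (L *m z)).
    by rewrite -!frob_sqr ler_sqr ?nnegrE ?frob_ge0.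
  rewrite -(all_subcol (fun z => frob (diagc (subcol p 0 d) *m z) <= frob (L *m z) /\
    frob (L *m z) <= u * frob (diagc (subcol p 0 d) *m z))) /P /Q /=.
  split=> -[d0 h]; (split=> [i|z sz]).
  - by rewrite mxE; apply: d0.
  - by rewrite fE frob_le_mul //; have := h z sz; rewrite E2 ?E3.
  - by have := d0 i; rewrite mxE.
  - by rewrite E2 ?E3 // -fE -frob_le_mul //; apply: h.
split=> -[u0 [d sd Pd]]; split=> //; exists d => //; exact/(PE d u0 sd).
Qed.

Lemma posdiagP p (D : 'M[R]_p) :
  posdiag D <-> exists d : 'cV[R]_p, (forall i, 0 < d i 0) /\ D = diagc d.
Proof.
split=> [[/is_diag_mxP dD D0]|[d [d0 ->]]].
  exists (\col_i D i i); split=> [i|]; first by rewrite mxE.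
  apply/matrixP => i j; rewrite !mxE; have [->|/dD ->] := eqVneq i j; first by rewrite mulr1n.
  by rewrite mulr0n.
split=> [|i]; first exact: diag_mx_is_diag.
by rewrite !mxE eqxx mulr1n.
Qed.

Lemma posdiag_unit p (D : 'M[R]_p) : posdiag D -> D \in unitmx.
Proof.
move=> [dD D0]; rewrite unitmxE (det_trig (is_diag_mx_is_trig dD)) unitfE.
by apply/prodf_neq0 => i _; rewrite gt_eqF.
Qed.

Lemma invmx_mulV p (L D : 'M[R]_p) : L \in unitmx -> D \in unitmx ->
  invmx (L *m invmx D) = D *m invmx L.
Proof.
move=> Lu Du; have LDu : L *m invmx D \in unitmx by rewrite unitmx_mul unitmx_inv Lu.
rewrite -[LHS]mulmx1 -[1%:M](_ : L *m invmx D *m (D *m invmx L) = _).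
  by rewrite mulKmx.
by rewrite mulmxA mulmxKV // mulmxV.
Qed.

Lemma unitmx_neq0 p (L : 'M[R]_p) : (0 < p)%N -> L \in unitmx -> L != 0.
Proof.
case: p L => // p L _; apply: contraL => /eqP ->.
by rewrite unitmxE det0 unitr0.
Qed.

(* After rescaling [D] so that [spec (D L^-1) <= 1], the condition number becomes a bound
   on quadratic forms, which is first-order expressible. *)
Lemma kappa_boundP p (L : 'M[R]_p) u : (0 < p)%N -> L \in unitmx ->
  kappa_bound L u <->
  exists2 D : 'M[R]_p, posdiag D & kappa2 (L *m invmx D) <= u.
Proof.
move=> p0 Lu; split=> [[u0 [d [d0 dP]]]|[D pD]].
  exists (diagc d); first by apply/posdiagP; exists d.
  have Du : diagc d \in unitmx by apply: posdiag_unit; apply/posdiagP; exists d.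
  rewrite /kappa2 invmx_mulV // -[leRHS]mulr1; apply: ler_pM; rewrite ?spec_ge0 //.
    apply: spec_le => //; split=> // x; rewrite -mulmxA.
    by apply: (le_trans (dP _).2); rewrite mulKVmx.
  apply: spec_le => //; split=> // x; rewrite -mulmxA mul1r.
  by apply: (le_trans (dP _).1); rewrite mulKVmx.
have Du := posdiag_unit pD; have [d [d0 Dd]] := (posdiagP D).1 pD.
rewrite /kappa2 invmx_mulV //; set a := spec _; set b := spec _ => abu.
have a0 : 0 <= a by apply: spec_ge0.
have b0 : 0 < b by apply: spec_gt0 => //; rewrite unitmx_neq0 // unitmx_mul Du unitmx_inv.
have u0 : 0 <= u by apply: le_trans abu; rewrite mulr_ge0 // ltW.
split=> //; exists (b^-1 *: d); split=> [i|z].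
  by rewrite mxE mulr_gt0 ?invr_gt0.
have -> : diagc (b^-1 *: d) = b^-1 *: D by rewrite Dd /diagc linearZ /= [LHS]linearZ.
have -> : frob (b^-1 *: D *m z) = b^-1 * frob (D *m z).
  by rewrite -scalemxAl /frob -!/(fsq _) fsqZ sqrtrM ?sqr_ge0 // sqrtr_sqr gtr0_norm ?invr_gt0.
split.
  rewrite ler_pdivrMl //; have := frob_spec_mul (D *m invmx L) p0 (L *m z).
  by rewrite mulmxA mulmxKV.
have /le_trans := frob_spec_mul (L *m invmx D) p0 (D *m z).
rewrite mulmxA mulmxKV //; apply.
by rewrite mulrA ler_wpM2r ?frob_ge0 // ler_pdivlMr.
Qed.

(** By [kappa_boundP] the up-closure of the set of condition numbers is definable, and an up-closure
    has the same lower bounds as the set itself. The scaling [D = 1] shows that it is inhabited. *)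
Lemma kinf_is_glb p (L : 'M[R]_p) : (0 < p)%N -> L \in unitmx ->
  is_glb (fun k => exists D : 'M[R]_p, posdiag D /\ k = kappa2 (L *m invmx D)) (kinf L).
Proof.
move=> p0 Lu; apply: epsilon_spec.
have pos1 : posdiag (1%:M : 'M[R]_p).
  by split=> [|i]; [apply: scalar_mx_is_diag|rewrite mxE eqxx ltr01].
have [|||g [lb gt]] := @definable_upset_glb R _ (- 1) (kappa2 (L *m invmx 1%:M))
    (kappa_bound_definable L).
- move=> u v /= /(kappa_boundP _ p0 Lu)[D pD Du] uv.
  by apply/(kappa_boundP _ p0 Lu); exists D => //; apply: le_trans uv.
- by case=> /=; rewrite oppr_ge0 ler10.
- by apply/(kappa_boundP _ p0 Lu); exists 1%:M.
exists g; split=> [k [D [pD ->]]|u ub].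
  by apply: lb; apply/(kappa_boundP _ p0 Lu); exists D.
apply: gt => k /= /(kappa_boundP _ p0 Lu)[D pD]; apply: le_trans.
by apply: ub; exists D.
Qed.

End Kinf.

(** * Triangular factorization of a perturbed signature matrix *)

Section Signed.
Variable R : rcfType.

Definition signs p (J : 'rV[R]_p) := forall i, J 0 i ^+ 2 = 1.

(** Signs square to 1, so the two sides differ by the cross term. Off the diagonal one of [X i j],
    [X j i] vanishes and so does the cross term; on the diagonal it equals $2X_{ii}^2$. *)
Lemma low_entry p (J : 'rV[R]_p) (X : 'M[R]_p) i j : signs J -> is_trig_mx X ->
  X i j ^+ 2 + X j i ^+ 2 <= (X *m diag_mx J + diag_mx J *m X^T) i j ^+ 2.
Proof.
move=> sJ /is_trig_mxP tX; rewrite mxE mul_mx_diag mul_diag_mx !mxE.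
rewrite sqrrD !exprMn !sJ mulr1 mul1r addrAC lerDl.
case: (ltngtP i j) => [/tX ->|/tX ->|/val_inj ->]; rewrite ?mul0r ?mulr0 ?mul0rn //.
rewrite pmulrn_lge0 // mulrA -[X in X * _]mulrA -expr2 sJ mulr1 -expr2.
exact: sqr_ge0.
Qed.

(** Summing the entrywise bound over all [(i, j)] counts every entry of [X] twice, once through the
    transpose. *)
Lemma fsq_low p (J : 'rV[R]_p) (X : 'M[R]_p) : signs J -> is_trig_mx X ->
  2 * fsq X <= fsq (X *m diag_mx J + diag_mx J *m X^T).
Proof.
move=> sJ tX; rewrite mulr_natl mulr2n -[X in _ + X]fsq_tr /fsq -big_split.
apply: ler_sum => i _; rewrite -big_split; apply: ler_sum => j _.
by rewrite mxE; apply: low_entry.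
Qed.

(** Scaling by [d] multiplies row [i] by the same factor on both sides, so the entrywise bound
    survives once the transposed entry is dropped. *)
Lemma fsq_diag_low p (J : 'rV[R]_p) (X : 'M[R]_p) (d : 'rV[R]_p) :
  signs J -> is_trig_mx X ->
  fsq (diag_mx d *m X) <= fsq (diag_mx d *m (X *m diag_mx J + diag_mx J *m X^T)).
Proof.
move=> sJ tX; apply: ler_sum => i _; apply: ler_sum => j _.
rewrite !(mul_diag_mx d) [X in X ^+ 2 <= _]mxE [X in _ <= X ^+ 2]mxE !exprMn.
rewrite ler_wpM2l ?sqr_ge0 //; apply: (le_trans _ (low_entry i j sJ tX)).
by rewrite lerDl sqr_ge0.
Qed.

Lemma fsq_mul_signs p q (J : 'rV[R]_p) (X : 'M[R]_(q, p)) : signs J ->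
  fsq (X *m diag_mx J) = fsq X.
Proof.
move=> sJ; apply: eq_bigr => i _; apply: eq_bigr => j _.
by rewrite mul_mx_diag mxE exprMn sJ mulr1.
Qed.

Lemma signs_invol p (J : 'rV[R]_p) : signs J -> diag_mx J *m diag_mx J = 1%:M.
Proof.
move=> sJ; rewrite mulmx_diag; apply/matrixP => i j.
by rewrite !mxE -expr2 sJ.
Qed.

Lemma signed_perturb p (J : 'rV[R]_p) (X E : 'M[R]_p) :
  (1%:M + X) *m diag_mx J *m (1%:M + X)^T = diag_mx J + E ->
  X *m diag_mx J + diag_mx J *m X^T = E - X *m diag_mx J *m X^T.
Proof.
rewrite linearD /= trmx1 !mulmxDl !mulmxDr !mul1mx !mulmx1 -!addrA => /addrI <-.
by rewrite addrCA !addrA addrK addrC.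
Qed.

(** When [frob E < 1/2] this excludes [fsq X = 1/2], where the left side would be 1 and the right
    side less than 1. *)
Lemma signed_quadratic p (J : 'rV[R]_p) (X E : 'M[R]_p) : signs J -> is_trig_mx X ->
  (1%:M + X) *m diag_mx J *m (1%:M + X)^T = diag_mx J + E ->
  Num.sqrt 2 * frob X <= frob E + fsq X.
Proof.
move=> sJ tX /signed_perturb eqX.
have -> : Num.sqrt 2 * frob X = Num.sqrt (2 * fsq X) by rewrite sqrtrM ?ler0n.
apply: le_trans (ler_wsqrtr (fsq_low sJ tX)) _.
rewrite -/(frob _) eqX; apply: le_trans (frobD _ _) _.
rewrite frobN lerD2l; apply: le_trans (frobM _ _) _.
by rewrite frob_tr /frob -!/(fsq _) fsq_mul_signs // -expr2 sqr_sqrtr ?fsq_ge0.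
Qed.

Lemma trig_unit p (Y : 'M[R]_p) : is_trig_mx Y -> (forall i, 0 < Y i i) -> Y \in unitmx.
Proof.
move=> tY Y0; rewrite unitmxE (det_trig tY) unitfE.
by apply/prodf_neq0 => i _; rewrite gt_eqF.
Qed.

Lemma trig_add1 p (X : 'M[R]_p) : is_trig_mx X -> is_trig_mx (1%:M + X).
Proof.
move=> /is_trig_mxP tX; apply/is_trig_mxP => i j ij.
by rewrite !mxE tX // addr0 -val_eqE ltn_eqF.
Qed.

(* Along the path [w = sqrt (1 + tau c)] the bounded quantity is polynomial in [w]
   (in [tau] when [c = 0]), so it cannot cross [1/2] without attaining it. *)
Lemma sqrt_path (a b c : R) : a < 1 / 2 -> 0 <= a -> 0 <= b ->
  (forall tau w, 0 <= tau <= 1 -> 0 <= w -> w ^+ 2 = 1 + tau * c ->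
     a + tau * b + (w - 1) ^+ 2 != 1 / 2) ->
  0 < 1 + c /\ a + b + (Num.sqrt (1 + c) - 1) ^+ 2 < 1 / 2.
Proof.
move=> a12 a0 b0 /(_ _ _ _ _ _)/eqP ncross.
have [c0|c0] := eqVneq c 0.
  rewrite c0 addr0 sqrtr1 subrr expr0n addr0; split; first lra.
  rewrite ltNge; apply/negP => ab.
  have bp : 0 < b by lra.
  (* For [c = 0] the quantity is affine in [tau], and this [tau] solves [a + tau * b = 1/2]. *)
  apply: (ncross ((1 / 2 - a) / b) 1) => //.
  - rewrite divr_ge0 ?ler_pdivrMr //=; lra.
  - by rewrite c0 mulr0 addr0 expr1n.
  - by rewrite divfK ?gt_eqF // subrr expr0n addr0; lra.
(* The path is parametrised by [w1], with [tau] recovered as [(w1 ^+ 2 - 1) / c]; the start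
   [tau = 0] is [w1 = 1]. *)
have stop w1 : 0 <= w1 -> 0 <= (w1 ^+ 2 - 1) / c <= 1 ->
    a + (w1 ^+ 2 - 1) / c * b + (w1 - 1) ^+ 2 < 1 / 2.
  move=> w10 /andP[t0 t1]; rewrite ltNge; apply/negP => ge.
  (* [F] is the bounded quantity minus 1/2. It is negative at 1, so a nonnegative value at [w1]
     yields a root between 1 and [w1], that is, a forbidden crossing. *)
  pose F : {poly R} := (a - 1 / 2)%:P + (b / c) *: ('X ^+ 2 - 1) + ('X - 1) ^+ 2.
  have FE w : F.[w] = a + (w ^+ 2 - 1) / c * b + (w - 1) ^+ 2 - 1 / 2.
    by rewrite /F !hornerE; ring.
  have F1 : F.[1] < 0 by rewrite FE subrr !expr1n subrr !mul0r; lra.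
  have Fw : 0 <= F.[w1] by rewrite FE; lra.
  have [w [w0 wt rw]] : exists w, [/\ 0 <= w, 0 <= (w ^+ 2 - 1) / c <= 1 & root F w].
    move: c0; rewrite neq_lt => /orP[cn|cp].
      have w1le : w1 <= 1.
        by move: t0; rewrite ler_ndivlMr // mul0r subr_le0 expr_le1.
      have [|w wI rw] := @polyrcf.poly_ivt _ F w1 1 w1le; first by rewrite nmulr_lle0.
      move: wI; rewrite in_itv /= => /andP[ww1 w1x].
      exists w; split; [lra| |exact: rw].
      move: t1; rewrite ler_ndivlMr // ler_ndivrMr // ler_ndivrMr // mul0r mul1r.
      by move=> h; apply/andP; split; nra.
    have w1ge : 1 <= w1.
      by move: t0; rewrite ler_pdivlMr // mul0r subr_ge0 expr_ge1.
    have [|w wI rw] := @polyrcf.poly_ivt _ F 1 w1 w1ge; first by rewrite nmulr_rle0.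
    move: wI; rewrite in_itv /= => /andP[ww1 w1x].
    exists w; split; [lra| |exact: rw].
    move: t1; rewrite ler_pdivlMr // ler_pdivrMr // ler_pdivrMr // mul0r mul1r.
    by move=> h; apply/andP; split; nra.
  apply: (ncross ((w ^+ 2 - 1) / c) w wt w0).
    by rewrite divfK // addrC subrK.
  by move: rw => /rootP; rewrite FE; lra.
(* Otherwise the path would reach [w = 0] at [tau = - c^-1], where the quantity is at least 1. *)
have c1 : 0 < 1 + c.
  rewrite ltNge; apply/negP => c1.
  have cn : c < 0 by lra.
  have ci : c^-1 < 0 by rewrite invr_lt0.
  have := stop 0 (lexx _); rewrite expr0n /= !sub0r mulN1r sqrrN expr1n => stop0.
  have ci0 : 0 <= - c^-1 by rewrite oppr_ge0 ltW.
  have ci1 : - c^-1 <= 1 by rewrite -invrN invf_le1; lra.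
  have := mulr_ge0 ci0 b0; move: stop0; rewrite ci0 ci1 => /(_ isT); lra.
split=> //; have w0 := sqrtr_ge0 (1 + c); have := stop _ w0.
rewrite sqr_sqrtr ?(ltW c1) // [1 + c]addrC addrK divff // [1 * b]mul1r.
by rewrite ler01 lexx; apply.
Qed.

(** One bordering step: a new row [(x^T, w)] leaves the leading block alone, so it is determined by
    a linear system for [x] and a scalar equation for [w]. *)
Lemma mul_signed_block p (Y : 'M[R]_p) (x : 'cV_p) (w j : R) (J : 'rV_p) :
  let Z := block_mx Y 0 x^T w%:M : 'M_(p + 1) in
  Z *m diag_mx (row_mx J j%:M) *m Z^T =
  block_mx (Y *m diag_mx J *m Y^T) (Y *m diag_mx J *m x)
           (x^T *m diag_mx J *m Y^T) (x^T *m diag_mx J *m x + (w ^+ 2 * j)%:M).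
Proof.
have -> : diag_mx (row_mx J j%:M) = block_mx (diag_mx J) 0 0 j%:M.
  by rewrite diag_mx_row; congr block_mx; apply/matrixP => a b; rewrite !ord1 !mxE.
rewrite /= tr_block_mx !mulmx_block !trmx0 !trmxK tr_scalar_mx.
rewrite !(mulmx0, mul0mx, addr0, add0r); congr block_mx.
by rewrite -!scalar_mxM; congr (_ + _%:M); ring.
Qed.

(* Induction on leading blocks: scaling the new off-diagonal entries of [E] by [sqrt tau]
   and the new diagonal entry by [tau] keeps [fsq E < 1/4], hence, by [signed_quadratic],
   keeps [fsq X] away from [1/2]. *)
Lemma signed_cholesky p (J : 'rV[R]_p) (E : 'M[R]_p) :
  signs J -> E^T = E -> fsq E < 1 / 4 ->
  exists X : 'M[R]_p, [/\ is_trig_mx X, forall i, 0 < 1 + X i i,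
    (1%:M + X) *m diag_mx J *m (1%:M + X)^T = diag_mx J + E & fsq X < 1 / 2].
Proof.
elim: p J E => [|p IH].
  move=> J E _ _ _; exists 0; split=> [|[]//||]; first exact: mx0_is_trig.
    by apply/matrixP => -[].
  by rewrite /fsq big_ord0; lra.
rewrite -(addn1 p) => J E.
rewrite -[J]hsubmxK [rsubmx J]mx11_scalar; set j := rsubmx J 0 0; set J1 := lsubmx J.
move=> sJ symE smallE.
have sJ1 : signs J1 by move=> i; have := sJ (lshift 1 i); rewrite row_mxEl.
have sj : j ^+ 2 = 1 by have := sJ (rshift p 0); rewrite row_mxEr mxE eqxx.
move: symE smallE; rewrite -[E]submxK [drsubmx E]mx11_scalar.
set E1 := ulsubmx E; set e := ursubmx E; set eta := drsubmx E 0 0.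
rewrite tr_block_mx => /eq_block_mx[symE1 _ <- _]; rewrite !fsq_block fsq_tr => smallE.
have fsq11 (a : R) : fsq (a%:M : 'M_1) = a ^+ 2.
  by rewrite /fsq !big_ord1 mxE eqxx.
rewrite fsq11 in smallE.
have e0 := fsq_ge0 e; have eta0 := sqr_ge0 eta.
have [|X1 [tX1 X1p eqX1 smallX1]] := IH J1 E1 sJ1 symE1; first lra.
set Y := 1%:M + X1 in eqX1.
have Yu : Y \in unitmx.
  by apply: trig_unit => [|i]; [apply: trig_add1|rewrite !mxE eqxx].
(* [x] matches the off-diagonal block; the signature matrix is its own inverse. *)
have [x Yx] : exists x, Y *m diag_mx J1 *m x = e.
  exists (diag_mx J1 *m (invmx Y *m e)).
  by rewrite -mulmxA (mulmxA (diag_mx J1)) signs_invol // mul1mx mulKVmx.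
(* The corner equation $t^2q+w^2j=j+t^2\eta$ becomes $w^2=1+t^2c$, because $j^2=1$. *)
pose q := (x^T *m diag_mx J1 *m x) 0 0; pose c := j * (eta - q).
pose X t w : 'M_(p + 1) := block_mx X1 0 (t *: x)^T (w - 1)%:M.
have tX t w : is_trig_mx (X t w).
  by rewrite is_trig_block_mx // eqxx tX1 mx11_is_trig.
have XE t w : w ^+ 2 = 1 + t ^+ 2 * c ->
    (1%:M + X t w) *m diag_mx (row_mx J1 j%:M) *m (1%:M + X t w)^T =
    diag_mx (row_mx J1 j%:M) + block_mx E1 (t *: e) (t *: e)^T (t ^+ 2 * eta)%:M.
  move=> wE; rewrite /X scalar_mx_block add_block_mx addr0 add0r -/Y.
  rewrite -raddfD /= addrC subrK mul_signed_block eqX1.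
  have -> : diag_mx (row_mx J1 j%:M) = block_mx (diag_mx J1) 0 0 j%:M.
    by rewrite diag_mx_row; congr block_mx; apply/matrixP => a b; rewrite !ord1 !mxE.
  rewrite add_block_mx !add0r; congr block_mx.
  - by rewrite -scalemxAr Yx.
  - by rewrite -Yx scalemxAr !trmx_mul !tr_diag_mx mulmxA.
  - rewrite -scalemxAr linearZ /= -!scalemxAl scalerA -expr2.
    rewrite [x^T *m _ *m x]mx11_scalar -/q scale_scalar_mx -!raddfD /=; congr _%:M.
    by rewrite wE /c; ring: sj.
have [c1 small1] : 0 < 1 + c /\ fsq X1 + fsq x + (Num.sqrt (1 + c) - 1) ^+ 2 < 1 / 2.
  apply: sqrt_path; rewrite ?fsq_ge0 // => tau w /andP[tau0 tau1] w0 wE.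
  have tE : Num.sqrt tau ^+ 2 = tau by rewrite sqr_sqrtr.
  have XEt := XE (Num.sqrt tau) w; rewrite tE in XEt.
  have := signed_quadratic sJ (tX _ _) (XEt wE).
  have fX : fsq (X (Num.sqrt tau) w) = fsq X1 + tau * fsq x + (w - 1) ^+ 2.
    by rewrite /X fsq_block fsq_tr fsqZ tE fsq11 fsq0 addr0.
  set F := block_mx E1 _ _ _.
  (* For [tau <= 1] the scaled entries only shrink, so [fsq F] stays below 1/4. *)
  have Fsmall : frob F < 1 / 2.
    rewrite ltNge; apply/negP => ge.
    have : (1 / 2) ^+ 2 <= frob F ^+ 2.
      by rewrite ler_sqr ?nnegrE ?frob_ge0 ?divr_ge0 ?ler0n.
    rewrite frob_sqr fsq_block fsq_tr fsqZ fsq11 tE.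
    have : tau * fsq e <= fsq e by rewrite ler_piMl.
    have : (tau * eta) ^+ 2 <= eta ^+ 2 by rewrite exprMn ler_piMl // expr_le1.
    lra.
  (* At [fsq X = 1/2] the quadratic inequality would read [1 <= frob F + 1/2]. *)
  rewrite -fX; apply: contraTneq => fX12.
  have -> : frob (X (Num.sqrt tau) w) = Num.sqrt (1 / 2) by rewrite -fX12.
  rewrite -sqrtrM ?ler0n // (_ : 2 * (1 / 2) = 1) ?sqrtr1 ?fX12; last by lra.
  by rewrite -ltNge; lra.
exists (X 1 (Num.sqrt (1 + c))); split => //.
- move=> i; rewrite /X; case: (split_ordP i) => k ->.
    by rewrite block_mxEul.
  by rewrite block_mxEdr ord1 mxE eqxx addrC subrK sqrtr_gt0.
- by rewrite XE ?expr1n ?mul1r ?scale1r // sqr_sqrtr // ltW.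
by rewrite /X fsq_block fsq_tr fsqZ expr1n mul1r fsq11 fsq0 addr0.
Qed.

End Signed.

(** * Perturbation bounds *)

Section Final.
Variable R : rcfType.

Definition Jrow m n : 'rV[R]_(m + n) := row_mx (const_mx 1) (const_mx (- 1)).

Lemma JmatE m n : Jmat R m n = diag_mx (Jrow m n).
Proof. by rewrite diag_mx_row !diag_const_mx raddfN. Qed.

Lemma signs_Jrow m n : signs (Jrow m n).
Proof.
by move=> i; rewrite mxE; case: (split i) => k; rewrite mxE ?sqrrN expr1n.
Qed.

(** The determinant of a block triangular matrix is the product of those of its diagonal blocks. In
    this form the condition is easily checked for products. *)
Lemma gchol_factorP m n (L : 'M[R]_(m + n)) :
  gchol_factor L <-> is_trig_mx L /\ L \in unitmx.
Proof.
split=> [[L11 [L21 [L22 [-> [t1 [u1 [t2 u2]]]]]]]|[tL uL]].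
  rewrite is_trig_block_mx // eqxx t1 t2; split=> //.
  by rewrite unitmxE det_lblock unitrM -!unitmxE u1 u2.
move: tL uL; rewrite -[L]submxK is_trig_block_mx // => /and3P[/eqP-> t1 t2].
rewrite unitmxE det_lblock unitrM -!unitmxE => /andP[u1 u2].
by do 3!eexists.
Qed.

Lemma trig_mulmx p (A B : 'M[R]_p) :
  is_trig_mx A -> is_trig_mx B -> is_trig_mx (A *m B).
Proof.
move=> /is_trig_mxP tA /is_trig_mxP tB; apply/is_trig_mxP => i j ij.
rewrite mxE big1 // => k _; have [ik|ki] := ltnP i k; first by rewrite tA ?mul0r.
by rewrite tB ?mulr0 // (leq_ltn_trans ki).
Qed.

(** The hypothesis rearranges to $(1-\sqrt2\,r)^2\ge 1-2f\ge 1-2\varepsilon$, and $r^2<1/2$ makes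
    $1-\sqrt2\,r$ positive, which selects the right branch when taking roots. *)
Lemma sqrt_gap (r f eps : R) : 0 <= r -> r ^+ 2 < 1 / 2 -> f <= eps ->
  Num.sqrt 2 * r <= f + r ^+ 2 ->
  Num.sqrt (1 - 2 * eps) <= 1 - Num.sqrt 2 * r.
Proof.
move=> r0 r12 feps h.
have s2 : Num.sqrt 2 ^+ 2 = 2 :> R by rewrite sqr_sqrtr ?ler0n.
have lt1 : Num.sqrt 2 * r < 1.
  rewrite -(ltr_pXn2r (ltn0Sn 1)) ?nnegrE ?mulr_ge0 ?sqrtr_ge0 //.
  by rewrite exprMn s2 expr1n; lra.
rewrite -[leRHS]gtr0_norm ?subr_gt0 // -sqrtr_sqr ler_wsqrtr //.
rewrite sqrrB expr1n mul1r exprMn s2; lra.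
Qed.

(** With [E = L^-1 dK L^-T], write [D E = (D L^-1) (dK L^-T)] to bound [frob (D X)] by a term in
    [dK] plus [frob (D X) * frob X]; the latter is absorbed on the left, and [L X = (L D^-1) (D X)]
    brings in the other factor of the condition number. *)
Lemma signed_diag_bound p (J : 'rV[R]_p) (X L D dK : 'M[R]_p) :
  (0 < p)%N -> signs J -> is_trig_mx X -> L \in unitmx -> posdiag D -> dK^T = dK ->
  (1%:M + X) *m diag_mx J *m (1%:M + X)^T =
    diag_mx J + invmx L *m dK *m (invmx L)^T ->
  frob X < 1 ->
  frob (L *m X) * (1 - frob X) <=
    kappa2 (L *m invmx D) * (spec (invmx L) * frob dK).
Proof.
move=> p0 sJ tX Lu pD symdK /signed_perturb eqX X1.
have Du := posdiag_unit pD; have [d [_ Dd]] := (posdiagP D).1 pD.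
have dKL : frob (dK *m (invmx L)^T) <= spec (invmx L) * frob dK.
  rewrite -frob_tr trmx_mul trmxK; apply: le_trans (frob_spec_mul _ p0 _) _.
  by rewrite frob_tr.
have DX : frob (D *m X) * (1 - frob X) <=
    spec (D *m invmx L) * (spec (invmx L) * frob dK).
  have : frob (D *m X) <= frob (D *m (X *m diag_mx J + diag_mx J *m X^T)).
    by apply: frob_le; rewrite Dd; apply: fsq_diag_low.
  rewrite mulrBr mulr1 lerBlDr => /le_trans; apply.
  rewrite eqX mulmxBr; apply: le_trans (frobD _ _) _; rewrite frobN.
  apply: lerD.
    have -> : D *m (invmx L *m dK *m (invmx L)^T) =
        D *m invmx L *m (dK *m (invmx L)^T) by rewrite !mulmxA.
    apply: le_trans (frob_spec_mul _ p0 _) _.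
    by rewrite ler_wpM2l ?spec_ge0.
  rewrite !mulmxA; apply: le_trans (frobM _ _) _.
  by rewrite frob_tr /frob -!/(fsq _) fsq_mul_signs.
rewrite /kappa2 invmx_mulV // -mulrA.
apply: le_trans (ler_wpM2l (spec_ge0 _ p0) DX).
rewrite mulrA ler_wpM2r ?subr_ge0 ?(ltW X1) //.
by have := frob_spec_mul (L *m invmx D) p0 (D *m X); rewrite mulmxA mulmxKV.
Qed.

End Final.

(** * Existence of the perturbed factor and the two norm bounds *)

Theorem theorem3p1 (R : rcfType) (m n : nat) (hm : (0 < m)%N) (hn : (0 < n)%N)
  (A : 'M[R]_m) (B : 'M[R]_(n, m)) (C : 'M[R]_n)
  (hA : posdef A) (hB : \rank B = n) (hC : possemidef C)
  (L : 'M[R]_(m + n))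
  (hL : gchol_factorization (block_mx A B^T B (- C)) L)
  (dK : 'M[R]_(m + n)) (hdK : sym dK)
  (hsmall : spec (invmx L) ^+ 2 * frob dK < 1 / 2) :
  exists dL : 'M[R]_(m + n),
    gchol_factorization (block_mx A B^T B (- C) + dK) (L + dL) /\
    frob dL <=
      Num.sqrt 2 * spec (invmx L) * kinf L /
        (Num.sqrt 2 - 1 + Num.sqrt (1 - 2 * spec (invmx L) ^+ 2 * frob dK))
      * frob dK /\
    Num.sqrt 2 * spec (invmx L) * kinf L /
        (Num.sqrt 2 - 1 + Num.sqrt (1 - 2 * spec (invmx L) ^+ 2 * frob dK))
      * frob dK
    <= (2 + Num.sqrt 2) * spec (invmx L) * kinf L * frob dK.
Proof.
have p0 : (0 < m + n)%N by rewrite addn_gt0 hm.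
case: hL => /gchol_factorP[tL Lu] ->; rewrite JmatE; set J := Jrow R m n.
have sJ : signs J by exact: signs_Jrow.
set E := invmx L *m dK *m (invmx L)^T; set a := spec (invmx L); set k := frob dK.
have a0 : 0 < a by rewrite spec_gt0 // unitmx_neq0 // unitmx_inv.
have k0 : 0 <= k := frob_ge0 dK.
have symE : E^T = E by rewrite /E !trmx_mul trmxK hdK mulmxA.
have frobE : frob E <= a ^+ 2 * k.
  rewrite /E -mulmxA; apply: le_trans (frob_spec_mul _ p0 _) _.
  rewrite expr2 -mulrA ler_wpM2l ?(ltW a0) // -frob_tr trmx_mul trmxK.
  by apply: le_trans (frob_spec_mul _ p0 _) _; rewrite frob_tr.
have smallE : fsq E < 1 / 4.
  have := frob_ge0 E; rewrite -frob_sqr; move: (frob E) frobE hsmall => f; rewrite -/a -/k; nra.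
have [X [tX Xp eqX smallX]] := signed_cholesky sJ symE smallE.
have r0 := frob_ge0 X; have r2 : frob X ^+ 2 < 1 / 2 by rewrite frob_sqr.
have r1 : frob X < 1 by nra.
have quad := signed_quadratic sJ tX eqX; rewrite -frob_sqr in quad.
have gap := sqrt_gap r0 r2 frobE quad.
have -> : 2 * a ^+ 2 * k = 2 * (a ^+ 2 * k) by rewrite mulrA.
move: gap; set s := Num.sqrt (1 - _) => gap.
have s0 : 0 <= s := sqrtr_ge0 _.
have two2 : Num.sqrt 2 ^+ 2 = 2 :> R by rewrite sqr_sqrtr ?ler0n.
have two0 : 0 <= Num.sqrt 2 :> R := sqrtr_ge0 _.
have two1 : 1 < Num.sqrt 2 :> R by nra.
set t := Num.sqrt 2 in gap two2 two0 two1 *.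
have den0 : 0 < t - 1 + s by lra.
have [lb gt] := kinf_is_glb p0 Lu.
have bound D : posdiag D ->
    frob (L *m X) * (t - 1 + s) <= t * a * k * kappa2 (L *m invmx D).
  move=> pD; have := signed_diag_bound p0 sJ tX Lu pD hdK eqX r1.
  rewrite -/a -/k => h.
  (* By [gap], [t - 1 + s <= t * (1 - frob X)]; this is where the denominator of the bound comes
     from. *)
  have : frob (L *m X) * (t - 1 + s) <= frob (L *m X) * (t * (1 - frob X)).
    by rewrite ler_wpM2l ?frob_ge0 //; lra.
  move=> /le_trans; apply; rewrite mulrCA.
  have -> : t * a * k * kappa2 (L *m invmx D) = t * (kappa2 (L *m invmx D) * (a * k)).
    by ring.
  by rewrite ler_wpM2l.
have kinf0 : 0 <= kinf L.
  by apply: gt => _ [D [_ ->]]; rewrite mulr_ge0 ?spec_ge0.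
have LX : L + L *m X = L *m (1%:M + X) by rewrite mulmxDr mulmx1.
exists (L *m X); rewrite LX; split; [split|split].
- apply/gchol_factorP; split.
    by rewrite trig_mulmx ?trig_add1.
  rewrite unitmx_mul Lu trig_unit ?trig_add1 // => i.
  by have := Xp i; rewrite !mxE eqxx.
- rewrite JmatE trmx_mul.
  rewrite [LHS](_ : _ = L *m (diag_mx J + E) *m L^T).
    by rewrite -eqX !mulmxA.
  rewrite mulmxDr mulmxDl /E !mulmxA mulmxV // mul1mx; congr (_ + _).
  by rewrite -mulmxA -trmx_mul mulmxV // trmx1 mulmx1.
- rewrite mulrAC ler_pdivlMr //.
  (* Passing to the infimum divides by [t * a * k], so [k = 0] is treated apart, with the scaling
     [D = 1]. *)
  have [k00|kn0] := eqVneq k 0.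
    have pos1 : posdiag (1%:M : 'M[R]_(m + n)).
      by split=> [|i]; [apply: scalar_mx_is_diag|rewrite mxE eqxx ltr01].
    by have := bound _ pos1; rewrite k00 !mulr0 mul0r.
  have kp : 0 < k by rewrite lt0r kn0.
  have tak : 0 < t * a * k by rewrite !mulr_gt0 //; lra.
  (* The quotient is a lower bound of all the condition numbers, hence at most their infimum. *)
  have : frob (L *m X) * (t - 1 + s) / (t * a * k) <= kinf L.
    by apply: gt => _ [D [pD ->]]; rewrite ler_pdivrMr // [leRHS]mulrC bound.
  by rewrite ler_pdivrMr // (_ : kinf L * _ = t * a * kinf L * k) //; ring.
- rewrite ler_wpM2r // ler_pdivrMr //.
  (* Since $t^2=2$, $(2+t)(t-1)=t$, and [s] is nonnegative. *)
  have aux : t <= (2 + t) * (t - 1 + s) by nra.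
  have := ler_wpM2r (mulr_ge0 (ltW a0) kinf0) aux.
  rewrite mulrA [leRHS](_ : _ = (2 + t) * a * kinf L * (t - 1 + s)) //; ring.
Qed.
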